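(* If $X$ is a nondegenerate dart in $\mathbb{R}$ which is compactly supported, then $X$ is not reasonable with respect to some nonnegative continuous payoff function with compact support. Furthermore, if $X$ is a dart in $\mathbb{R}^n$ for which some projection $h(X)$ (with $h:\mathbb{R}^n\to\mathbb{R}$ a nonzero linear function) is nondegenerate and compactly supported, then $X$ is not reasonable with respect to some nonnegative continuous payoff function on $\mathbb{R}^n$ with compact support.
   Context: A dart is a random vector $X$ taking values in $\mathbb{R}^n$. Nondegenerate means that the distribution is not a single point mass (not almost surely constant). Compactly supported means that the distribution is supported on a compact set. A payoff function is a measurable function $f:\mathbb{R}^n\to\mathbb{R}$ bounded from above. For $d>0$, $g_{X,f}(d):=\sup_{a\in\mathbb{R}^n}Ef(a+dX)$. $X$ is reasonable with respect to $f$ (i.e. the pair $(X,f)$ is reasonable) if $g_{X,f}(d)$ is decreasing (i.e. non-increasing) in $d\in(0,\infty)$. *)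

(* Defs.v *)
From HB Require Import structures.
From mathcomp Require Import all_boot all_order all_algebra.
From mathcomp Require Import all_classical all_reals all_analysis.

Set Implicit Arguments.
Unset Strict Implicit.
Unset Printing Implicit Defensive.

Import Order.TTheory GRing.Theory Num.Theory.
Import numFieldNormedType.Exports.

Local Open Scope classical_set_scope.
Local Open Scope ring_scope.

(* [V] with its Borel sigma-algebra; the library puts no measurable structure
   on ['rV[R]_n]. A dart in R^n is a random variable with values in
   [borel 'rV[R]_n], and a dart in R is a real random variable. *)
Notation borel V := (g_sigma_algebraType (@open V)).

Section Darts.
Context (R : realType) (d : measure_display) (T : measurableType d).
Context (P : probability T R) (V : normedModType R).

Definition nondegenerate_dart (X : T -> V) : Prop :=
  ~ exists c : V, {ae P, forall w, X w = c}.

Definition compactly_supported (X : T -> V) : Prop :=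
  exists2 K : set V, compact K & {ae P, forall w, K (X w)}.

Definition payoff (f : V -> R) : Prop :=
  measurable_fun [set: borel V] (f : borel V -> R) /\
  exists M : R, forall x, f x <= M.

(* The expectation of a payoff is at most its upper bound but may be [-oo],
   hence the extended real codomain. *)
Definition optimal_payoff (X : T -> V) (f : V -> R) (r : R) : \bar R :=
  ereal_sup (range (fun a : V => 'E_P[fun w => f (a + r *: X w)%R]%E)).

Definition reasonable (X : T -> V) (f : V -> R) : Prop :=
  forall r s : R, 0 < r -> r <= s ->
    (optimal_payoff X f s <= optimal_payoff X f r)%E.

Definition compact_support (f : V -> R) : Prop :=
  compact (closure [set x | f x != 0]).

End Darts.

(* Main.v *)
Require Import Defs.
From HB Require Import structures.
From mathcomp Require Import all_boot all_order all_algebra.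
From mathcomp Require Import all_classical all_reals all_analysis.
From mathcomp Require Import measurable_realfun ring lra.

Import Order.TTheory GRing.Theory Num.Theory.
Import numFieldNormedType.Exports.

Local Open Scope classical_set_scope.
Local Open Scope ring_scope.

(** The idea. If a real dart [Y] were reasonable for every payoff, duality
    would make [Y] distributed as [A + c Y] with [A] independent of [Y], for
    every [0 < c < 1]. When the convex hull of the support of [Y] has finite
    length [L], that of [A] has length [(1 - c) L]; hence
    [(1 - c^2) Var Y = Var A <= (1 - c)^2 L^2], and letting [c] tend to [1]
    forces [Var Y = 0]. A nondegenerate [Y] is thus not reasonable, and the
    two ingredients, support and variance, indicate an explicit bad payoff.

    Let [Z = Y - E Y], with variance [v > 0]. The payoff is
    [f x = (K + x^2) chi x], where [chi] is a continuous cutoff equal to [1] on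
    the range of [Z] and [0] slightly outside of it. Then [E f(Z) = K + v]. For
    [c] slightly less than [1] and any [b], either [|b|] is so large that
    [b + c Z] leaves the support of [f] with a probability bounded away from
    [0], and the loss outweighs everything else once [K] is large, or [b] is of
    order [1 - c] and [E f(b + c Z) <= K + b^2 + c^2 v]. The latter is less than
    [K + v], since [b^2] is of order [(1 - c)^2] while [(1 - c^2) v] is of order
    [1 - c]. This is [centered_separating_payoff], and [separating_payoff]
    removes the centering.

    In a normed space, if [h X] is such a [Y] for a linear form [h], the payoff
    [f (h x)] has the same property, but its support is only a slab. Multiplying
    it by a cutoff [psi] with values in [[0, 1]] that vanishes far from the
    origin makes the support compact; it lowers every expected payoff, hence
    keeps the upper bound at distance [c], and by dominated convergence it
    preserves the strict lower bound at distance [1] when the cutoff radius is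
    large. This is [not_reasonable_of_projection]. The real line is the case
    where [h] is the identity. *)

(** * Continuous cutoffs and measurability *)

Definition ramp {R : realType} (t : R) : R := Num.max 0 (Num.min 1 t).

Lemma ramp_ge0 {R : realType} (t : R) : 0 <= ramp t.
Proof. by rewrite /ramp le_max lexx. Qed.

Lemma ramp_le1 {R : realType} (t : R) : ramp t <= 1.
Proof. by rewrite /ramp ge_max ler01 ge_min lexx. Qed.

Lemma ramp_eq1 {R : realType} (t : R) : 1 <= t -> ramp t = 1.
Proof. by move=> t1; rewrite /ramp (min_idPl t1) (max_idPr ler01). Qed.

Lemma ramp_eq0 {R : realType} (t : R) : t <= 0 -> ramp t = 0.
Proof. by move=> t0; apply/max_idPl; rewrite ge_min t0 orbT. Qed.

Lemma ramp_continuous {R : realType} : continuous (ramp : R -> R).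
Proof.
apply: (@max_fun_continuous _ R R (cst 0) (fun t => Num.min 1 t)) => [x|].
  exact: cvg_cst.
apply: (@min_fun_continuous _ R R (cst 1) idfun) => x; first exact: cvg_cst.
exact: cvg_id.
Qed.

Lemma measurable_fun_comp_continuous {R : realType} {d : measure_display}
    {T : measurableType d} {V : normedModType R} (X : T -> V) (g : V -> R) :
  (forall O : set V, open O -> measurable (X @^-1` O)) -> continuous g ->
  measurable_fun [set: T] (fun w => g (X w)).
Proof.
move=> mX /continuousP cg.
apply: (measurability _ (RGenOpens.measurableE R)).
move=> _ [_ [a [b ->] <-]]; rewrite setTI.
exact: (mX (g @^-1` _) (cg _ (interval_open _ _))).
Qed.

Lemma measurable_superlevel {R : realType} {d : measure_display}
    {T : measurableType d} (Y : T -> R) (t : R) :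
  measurable_fun [set: T] Y -> measurable [set w | t < Y w].
Proof.
move=> mY; have -> : [set w | t < Y w] = [set: T] `&` Y @^-1` `]t, +oo[.
  by rewrite setTI; apply/seteqP; split => w /=; rewrite in_itv/= andbT.
exact: mY.
Qed.

(** * Essentially bounded random variables *)

Section bounded_variable.
Context {R : realType} {d : measure_display} {T : measurableType d}.
Variables (P : probability T R) (Z : T -> R) (B : R).
Hypothesis mZ : measurable_fun [set: T] Z.
Hypothesis ZB : {ae P, forall w, `|Z w| <= B}.

(** A substitute for the essential supremum [s] of [Z], with precision [tau].
    The choice of [s + tau / 2] instead of [s] makes the last two conclusions
    immediate, with no limit of events: [u] lies strictly above [s] and
    [u - tau] strictly below. *)
Lemma ess_upper_edge (tau : R) : 0 < tau ->
  exists u, [/\ u <= B + tau, {ae P, forall w, Z w <= u}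
              & (0 < P [set w | (u - tau < Z w)%R])%E].
Proof.
move=> tau0; pose U t := [set w | t < Z w]; pose S := [set t | (0 < P (U t))%E].
have mU t : measurable (U t) by exact: measurable_superlevel.
have [N [mN N0 sN]] := ZB.
have SB t : S t -> t <= B.
  move=> St; rewrite leNgt; apply/negP => Bt.
  suff : (P (U t) <= P N)%E by rewrite N0 leNgt; move/negP; apply.
  apply: le_measure; rewrite ?inE //; apply: subset_trans sN => w /=.
  by rewrite /U /= => tZ /(le_trans (ler_norm _)) ZB'; lra.
have S0 : S (- B - 1).
  rewrite /S /= lt0e measure_ge0 andbT; apply/eqP => Z0.
  have : (P [set: T] <= P (U (- B - 1)%R `|` N))%E.
    apply: le_measure; rewrite ?inE //; first exact: measurableU.
    move=> w _; have [wN|wN] := pselect (N w); [by right|left].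
    have : `|Z w| <= B by apply: contrapT => /sN.
    by rewrite ler_norml /U /= => /andP[? ?]; lra.
  have -> : P (U (- B - 1) `|` N) = 0%E by rewrite measureU0.
  by rewrite probability_setT leNgt lte01.
have supS : has_sup S by split; [exists (- B - 1) | exists B => t /SB].
have [t St tS] := sup_adherent (divr_gt0 tau0 (ltr0Sn R 1)) supS.
exists (sup S + tau / 2); split.
- have : sup S <= B by apply: ge_sup; [exists (- B - 1) | move=> s /SB].
  lra.
- exists (U (sup S + tau / 2)); split => //.
    apply/eqP; rewrite eq_le measure_ge0 andbT leNgt; apply/negP => Su.
    by have := sup_upper_bound supS Su; lra.
  by move=> w /= /negP; rewrite -ltNge.
- apply: (lt_le_trans St); apply: le_measure; rewrite ?inE; [exact: mU..|].
  by rewrite /U => w /=; lra.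
Qed.

Lemma ae_bounded_integrable (g : R -> R) (M : R) : continuous g ->
  (forall x, `|x| <= B -> `|g x| <= M) ->
  P.-integrable setT (fun w => (g (Z w))%:E).
Proof.
move=> cg gM.
have mgZ : measurable_fun [set: T] (fun w => g (Z w)).
  exact: (measurableT_comp (continuous_measurable_fun cg) mZ).
apply/integrableP; split; first exact/measurable_EFinP.
apply: (@le_lt_trans _ _ (\int[P]_w (`|M|)%:E)%E); last first.
  by rewrite integral_cst//= probability_setT mule1 ltry.
apply: ae_ge0_le_integral => //.
- by apply: measurableT_comp => //; exact/measurable_EFinP.
- case: ZB => N [mN N0 sN]; exists N; split => //.
  apply: subset_trans sN => w /= nle Zw; apply: nle => _.
  by rewrite lee_fin (le_trans (gM _ Zw))// ler_norm.
Qed.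


Lemma integral_quadratic (v a b c : R) :
  (\int[P]_w (Z w)%:E = 0)%E -> (\int[P]_w (Z w ^+ 2)%:E = v%:E)%E ->
  (\int[P]_w (a + b * Z w + c * Z w ^+ 2)%:E = (a + c * v)%:E)%E.
Proof.
move=> EZ EZ2.
have iZ : P.-integrable setT (fun w => (Z w)%:E).
  by apply: (ae_bounded_integrable idfun B) => // x; exact: cvg_id.
have iZ2 : P.-integrable setT (fun w => (Z w ^+ 2)%:E).
  apply: (ae_bounded_integrable (fun x => x ^+ 2) (B ^+ 2)).
    exact: exprn_continuous.
  by move=> x xB; rewrite normrX ler_pXn2r// nnegrE ?(le_trans (normr_ge0 x)).
have i1 : P.-integrable setT (fun=> a%:E).
  exact: finite_measure_integrable_cst.
have ibZ : P.-integrable setT (fun w => b%:E * (Z w)%:E)%E.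
  exact: integrableZl.
have icZ : P.-integrable setT (fun w => c%:E * (Z w ^+ 2)%:E)%E.
  exact: integrableZl.
have iab : P.-integrable setT (fun w => a%:E + b%:E * (Z w)%:E)%E.
  exact: integrableD.
under eq_integral do rewrite 2!EFinD (EFinM b) (EFinM c).
rewrite integralD// integralD// integralZl// integralZl// EZ EZ2.
by rewrite integral_cst//= probability_setT mule1 mule0 adde0 -EFinM -EFinD.
Qed.

End bounded_variable.

(** * A payoff that separates two distances *)

Lemma ge0_integral_le_off_event {R : realType} {d : measure_display}
    {T : measurableType d} (P : probability T R) (A : set T) (g : T -> R)
    (C p : R) : measurable A -> measurable_fun [set: T] g ->
  (forall w, 0 <= g w <= C) -> (forall w, A w -> g w = 0) -> P A = p%:E ->
  (\int[P]_w (g w)%:E <= (C * (1 - p))%:E)%E.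
Proof.
move=> mA mg g0C gA PA.
have -> : (C * (1 - p))%:E = (\int[P]_w (C%:E * (\1_(~` A) w)%:E))%E.
  rewrite integralZl//; last first.
    by apply: integrable_indic; exact: measurableC.
  rewrite integral_indic//; last exact: measurableC.
  by rewrite setIT /= probability_setC// PA -EFinB -EFinM.
apply: ge0_le_integral => //.
- by move=> w _; rewrite lee_fin; case/andP: (g0C w).
- exact/measurable_EFinP.
- apply/measurable_EFinP; apply: (measurable_funM (f := cst C)) => //.
  by apply: measurable_indic; exact: measurableC.
- move=> w _; rewrite -EFinM lee_fin; have /andP[_ gC] := g0C w.
  rewrite indicE in_setC; have [wA|_] := boolP (w \in A).
    by rewrite mulr0 gA//; exact: set_mem.
  by rewrite mulr1.
Qed.

(** The payoff rewards variance on the range of [Z] and is zero just outside: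
    at distance [1] the dart fits exactly, and at a slightly smaller distance
    [c] the second moment lost by shrinking, of order [1 - c], exceeds the
    second moment [b ^+ 2], of order [(1 - c) ^+ 2], that a shift by [b] can
    recover without leaving the range. *)
Lemma centered_separating_payoff {R : realType} {d : measure_display}
    {T : measurableType d} (P : probability T R) (Z : T -> R) (B v : R) :
  measurable_fun [set: T] Z -> {ae P, forall w, `|Z w| <= B} -> 0 < B ->
  (\int[P]_w (Z w)%:E = 0)%E -> (\int[P]_w (Z w ^+ 2)%:E = v%:E)%E -> 0 < v ->
  exists (f : R -> R) (c rho M : R),
    [/\ continuous f, (forall x, 0 <= f x <= M), 0 < c <= 1,
        (forall b, (\int[P]_w (f (b + c * Z w))%:E <= rho%:E)%E)
      & (rho%:E < \int[P]_w (f (Z w))%:E)%E].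
Proof.
move=> mZ ZB B0 EZ EZ2 v0.
have B2 : 0 < 16 * B ^+ 2 by rewrite mulr_gt0// exprn_gt0.
(* The shrinking [e = 1 - c] must satisfy [(4 B e) ^+ 2 + (1 - e) ^+ 2 * v < v],
   where [4 B e] will bound the shifts that lose no probability; with
   this value, [16 B ^+ 2 e < v] and [e < 1], so the two terms are less than
   [e v] and [(1 - e) v]. *)
pose e := v / (v + 16 * B ^+ 2).
have e0 : 0 < e by rewrite divr_gt0// addr_gt0.
have e1 : e < 1 by rewrite ltr_pdivrMr ?mul1r; lra.
have ev : e * (16 * B ^+ 2) = v - e * v by rewrite /e; field; lra.
(* Blurring the edges at the scale of the shrinking keeps the shifts that lose
   no probability of order [e]. *)
pose tau := B * e.
have tau0 : 0 < tau by rewrite mulr_gt0.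
have tauB : tau < B by rewrite /tau gtr_pMr.
have mNZ : measurable_fun [set: T] (fun w => - Z w) by exact: measurable_funN.
have NZB : {ae P, forall w, `|- Z w| <= B}.
  by apply: filterS ZB => w; rewrite normrN.
have [u [uB Zu Pu]] := ess_upper_edge P Z B mZ ZB tau tau0.
(* The lower edge of [Z] is [- l]. *)
have [l [lB Zl Pl]] := ess_upper_edge P (fun w => - Z w) B mNZ NZB tau tau0.
pose p := fine (P [set w | u - tau < Z w]).
pose q := fine (P [set w | l - tau < - Z w]).
have pE : P [set w | u - tau < Z w] = p%:E.
  by rewrite fineK// fin_num_measure//; exact: measurable_superlevel.
have qE : P [set w | l - tau < - Z w] = q%:E.
  by rewrite fineK// fin_num_measure//; exact: measurable_superlevel.
have p0 : 0 < p by rewrite -lte_fin -pE.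
have q0 : 0 < q by rewrite -lte_fin -qE.
(* [f] will be supported in [[- 3 B, 3 B]], where [x ^+ 2 <= N]. *)
pose N := 9 * B ^+ 2.
have N0 : 0 < N by rewrite mulr_gt0// exprn_gt0.
(* Losing an event of probability [p] lowers the bound [K + N] on an expected
   payoff by at least [K * p], which is at least [N]; likewise for [q]. *)
pose K := N / p + N / q.
have Np : 0 < N / p by rewrite divr_gt0.
have Nq : 0 < N / q by rewrite divr_gt0.
have Kp : N <= K * p.
  by rewrite /K mulrDl divfK ?gt_eqF// lerDl mulr_ge0// ltW.
have Kq : N <= K * q.
  by rewrite /K mulrDl (divfK (x := q)) ?gt_eqF// lerDr mulr_ge0// ltW.
have K0 : 0 < K by rewrite addr_gt0.
pose chi x := ramp (1 + (u - x) / tau) * ramp (1 + (l + x) / tau).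
have chi0 x : 0 <= chi x by rewrite mulr_ge0// ramp_ge0.
have chi1 x : chi x <= 1 by rewrite mulr_ile1// ?ramp_ge0// ramp_le1.
pose f x := (K + x ^+ 2) * chi x.
have q_ge0 x : 0 <= K + x ^+ 2 by rewrite addr_ge0// ?sqr_ge0// ltW.
have f_ge0 x : 0 <= f x by rewrite mulr_ge0.
have f_le_quadratic x : f x <= K + x ^+ 2 by rewrite ler_piMr.
have f_above x : u + tau <= x -> f x = 0.
  move=> ux; rewrite /f /chi ramp_eq0 ?mul0r ?mulr0//.
  rewrite -[1](divff (lt0r_neq0 tau0)) -mulrDl ler_pdivrMr// mul0r; lra.
have f_below x : l + tau <= - x -> f x = 0.
  move=> lx; rewrite /f /chi (ramp_eq0 (1 + (l + x) / tau)) ?mulr0//.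
  rewrite -[1](divff (lt0r_neq0 tau0)) -mulrDl ler_pdivrMr// mul0r; lra.
have f_plateau x : x <= u -> - x <= l -> f x = K + x ^+ 2.
  move=> xu xl; rewrite /f /chi !ramp_eq1 ?mulr1// lerDl divr_ge0 ?(ltW tau0)//;
    lra.
have f_bounded x : f x <= K + N.
  have [/f_above -> |xu] := leP (u + tau) x.
    by rewrite addr_ge0// ltW.
  have [/f_below -> |xl] := leP (l + tau) (- x).
    by rewrite addr_ge0// ltW.
  rewrite (le_trans (f_le_quadratic x))// lerD2l /N.
  by nra.
have cf : continuous f.
  have cr (h : R -> R) : continuous h ->
      continuous (fun x : R => ramp (1 + h x / tau)).
    move=> ch x; apply: (@continuous_comp _ _ _ (fun x : R => 1 + h x / tau)).
      apply: cvgD; first exact: cvg_cst.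
      by apply: cvgM; [exact: ch|exact: cvg_cst].
    exact: ramp_continuous.
  move=> x; apply: cvgM.
    by apply: cvgD; [exact: cvg_cst|exact: exprn_continuous].
  apply: cvgM.
    apply: (cr (fun x => u - x)) => y.
    by apply: cvgB; [exact: cvg_cst|exact: cvg_id].
  apply: (cr (fun x => l + x)) => y.
  by apply: cvgD; [exact: cvg_cst|exact: cvg_id].
pose c := 1 - e.
pose rho := K + 16 * B ^+ 2 * e ^+ 2 + c ^+ 2 * v.
have mf (a b : R) : measurable_fun [set: T] (fun w => f (a + b * Z w)).
  apply: (measurableT_comp (continuous_measurable_fun cf)).
  apply: measurable_funD => //; apply: measurable_funM => //.
exists f, c, rho, (K + N); split => //.
- by move=> x; rewrite f_ge0 f_bounded.
- by rewrite /c; lra.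
- move=> b.
  have far A r : measurable A -> P A = r%:E -> N <= K * r -> 0 < r ->
      (forall w, A w -> f (b + c * Z w) = 0) ->
      (\int[P]_w (f (b + c * Z w))%:E <= rho%:E)%E.
    move=> mA PA Kr r0 fA.
    have fKN w : 0 <= f (b + c * Z w) <= K + N by rewrite f_ge0 f_bounded.
    apply: (le_trans
      (ge0_integral_le_off_event _ _ _ _ _ mA (mf b c) fKN fA PA)).
    rewrite lee_fin /rho.
    have : 0 <= N * r by rewrite mulr_ge0// ltW.
    have : 0 <= 16 * B ^+ 2 * e ^+ 2 by rewrite mulr_ge0// ?sqr_ge0// ltW.
    have : 0 <= c ^+ 2 * v by rewrite mulr_ge0// ?sqr_ge0// ltW.
    lra.
  (* On [u - tau < Z], such a shift gives
     [b + c Z > u e + 2 tau + (1 - e) (u - tau) >= u + tau]. *)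
  have [bu|bu] := leP (u * e + 2 * tau) b.
    apply: (far _ _ (measurable_superlevel _ _ mZ) pE Kp p0) => w /= Zw.
    apply: f_above; rewrite /c; nra.
  have [bl|bl] := leP (l * e + 2 * tau) (- b).
    apply: (far _ _ (measurable_superlevel _ _ mNZ) qE Kq q0) => w /= Zw.
    apply: f_below; rewrite /c; nra.
  have bB : `|b| <= 4 * (B * e).
    by rewrite ler_norml /tau in uB lB bu bl tauB *; nra.
  apply: (@le_trans _ _
    (\int[P]_w ((K + b ^+ 2) + (2 * b * c) * Z w + c ^+ 2 * Z w ^+ 2)%:E)%E).
    apply: ge0_le_integral => //.
    - by move=> w _; rewrite lee_fin.
    - exact/measurable_EFinP.
    - apply/measurable_EFinP; apply: measurable_funD.
        by apply: measurable_funD => //; apply: measurable_funM.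
      by apply: measurable_funM => //; apply: measurable_funX.
    - move=> w _; rewrite lee_fin; apply: le_trans (f_le_quadratic _) _.
      by rewrite le_eqVlt; apply/orP; left; apply/eqP; ring.
  rewrite (integral_quadratic P Z B mZ ZB v)// lee_fin /rho lerD2r lerD2l.
  have -> : 16 * B ^+ 2 * e ^+ 2 = (4 * (B * e)) ^+ 2 by ring.
  rewrite -real_normK ?num_real// ler_pXn2r ?nnegrE//.
  by rewrite (le_trans (normr_ge0 b)).
- have -> : (\int[P]_w (f (Z w))%:E =
      \int[P]_w (K + 0 * Z w + 1 * Z w ^+ 2)%:E)%E.
    apply: ge0_ae_eq_integral => //.
    - apply/measurable_EFinP; have := mf 0 1.
      by under eq_fun do rewrite add0r mul1r.
    - apply/measurable_EFinP; apply: measurable_funD.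
        by apply: measurable_funD => //; apply: measurable_funM.
      by apply: measurable_funM => //; apply: measurable_funX.
    - by move=> w _; rewrite lee_fin.
    - by move=> w _; rewrite lee_fin mul0r addr0 mul1r.
    - apply: filterS2 Zu Zl => w wu wl _.
      by rewrite f_plateau// mul0r addr0 mul1r.
  rewrite (integral_quadratic P Z B mZ ZB v)// lte_fin /rho /c.
  nra.
Qed.

Lemma separating_payoff {R : realType} {d : measure_display}
    {T : measurableType d} (P : probability T R) (Y : T -> R) (B : R) :
  measurable_fun [set: T] Y -> {ae P, forall w, `|Y w| <= B} ->
  nondegenerate_dart P Y ->
  exists (f : R -> R) (c rho M a0 : R),
    [/\ continuous f, (forall x, 0 <= f x <= M), 0 < c <= 1,
        (forall a, (\int[P]_w (f (a + c * Y w))%:E <= rho%:E)%E)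
      & (rho%:E < \int[P]_w (f (a0 + Y w))%:E)%E].
Proof.
move=> mY YB Ynd.
have iY : P.-integrable setT (fun w => (Y w)%:E).
  by apply: (ae_bounded_integrable P Y B mY YB idfun B) => // x; exact: cvg_id.
pose m := fine (\int[P]_w (Y w)%:E)%E.
have mE : (\int[P]_w (Y w)%:E)%E = m%:E.
  by rewrite fineK//; exact: integrable_fin_num.
pose Z w := Y w - m.
have mZ : measurable_fun [set: T] Z by exact: measurable_funB.
pose D := `|B| + `|m| + 1.
have D0 : 0 < D by rewrite ltr_wpDl// addr_ge0.
have ZD : {ae P, forall w, `|Z w| <= D}.
  apply: filterS YB => w YBw; rewrite (le_trans (ler_normB _ _))// /D.
  by have := ler_norm B; lra.
have EZ : (\int[P]_w (Z w)%:E = 0)%E.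
  under eq_integral do rewrite EFinB.
  rewrite integralB//; last exact: finite_measure_integrable_cst.
  by rewrite mE integral_cst//= probability_setT mule1 subee.
have iZ2 : P.-integrable setT (fun w => (Z w ^+ 2)%:E).
  apply: (ae_bounded_integrable P Z D mZ ZD (fun x => x ^+ 2) (D ^+ 2)).
    exact: exprn_continuous.
  by move=> x xD; rewrite normrX ler_pXn2r// nnegrE ?(le_trans (normr_ge0 x)).
pose v := fine (\int[P]_w (Z w ^+ 2)%:E)%E.
have vE : (\int[P]_w (Z w ^+ 2)%:E)%E = v%:E.
  by rewrite fineK//; exact: integrable_fin_num.
have v0 : 0 < v.
  have v_ge0 : 0 <= v.
    by rewrite -lee_fin -vE integral_ge0// => w _; rewrite lee_fin sqr_ge0.
  rewrite lt_neqAle v_ge0 andbT; apply/negP => /eqP v_eq0.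
  apply: Ynd; exists m.
  have Z2_ae0 : {ae P, forall w, [set: T] w -> (Z w ^+ 2)%:E = 0%E}.
    apply/(ae_eq_integral_abs P measurableT (measurable_int _ iZ2)).
    under eq_integral do rewrite gee0_abs ?lee_fin ?sqr_ge0//.
    by rewrite vE -v_eq0.
  apply: filterS Z2_ae0 => w /(_ I) [] /eqP.
  by rewrite sqrf_eq0 subr_eq0 => /eqP.
(* The centering constant is absorbed by the shift, both at distance [c] and
   at distance [1]. *)
have [f [c [rho [M [cf fM c01 Eb E1]]]]] :=
  centered_separating_payoff P Z D v mZ ZD D0 EZ vE v0.
exists f, c, rho, M, (- m); split => // [a|].
  rewrite (eq_integral (fun w => (f ((a + c * m) + c * Z w))%:E)) => [|w _].
    exact: Eb.
  congr (f _)%:E; rewrite /Z; ring.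
by under eq_integral do rewrite addrC.
Qed.

(** * From a linear image to the dart *)

(** A shift of [X] by [a] is seen by [h] as a shift of [h X] by [h a], so
    composing a separating payoff for [h X] with [h] separates distances for
    [X]; a radial cutoff then makes the support compact. Surjectivity of [h]
    realises the shift of [h X] that is good at distance [1]. *)
Lemma not_reasonable_of_projection {R : realType} {d : measure_display}
    {T : measurableType d} (P : probability T R) (V : normedModType R)
    (X : T -> V) (h : V -> R) :
  (forall k : R, compact [set x : V | `|x| <= k]) ->
  (forall O : set V, open O -> measurable (X @^-1` O)) ->
  continuous h -> (forall a c x, h (a + c *: x) = h a + c * h x) ->
  (forall t, exists x, h x = t) ->
  nondegenerate_dart P (fun w => h (X w)) ->
  compactly_supported P (fun w => h (X w)) ->
  exists f : V -> R,
    [/\ payoff f, forall x, 0 <= f x, continuous f, compact_support f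
      & ~ reasonable P X f].
Proof.
move=> Vcompact mX ch hlin hsurj hnd [K Kc KX].
have [B KB] : exists B : R, forall x, K x -> `|x| <= B.
  have [B [_ hB]] := compact_bounded Kc.
  by exists (B + 1) => x Kx; apply: hB => //; rewrite ltrDl.
have mhX : measurable_fun [set: T] (fun w => h (X w)).
  exact: measurable_fun_comp_continuous mX ch.
have hXB : {ae P, forall w, `|h (X w)| <= B} by apply: filterS KX => w /KB.
have [f [c [rho [M [a0 [cf fM c01 Ec E1]]]]]] :=
  separating_payoff P _ B mhX hXB hnd.
have /andP[c0 c1] := c01.
have [x0 hx0] := hsurj a0.
pose psi (k : nat) (x : V) := ramp (k%:R + 1 - `|x|).
pose F k x := f (h x) * psi k x.
have cpsi k : continuous (psi k).
  move=> x; apply: (@continuous_comp _ _ _ (fun x : V => k%:R + 1 - `|x|)).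
    by apply: cvgB; [exact: cvg_cst|exact: norm_continuous].
  exact: ramp_continuous.
have cF k : continuous (F k).
  move=> x; apply: cvgM; last exact: cpsi.
  by apply: (@continuous_comp _ _ _ h); [exact: ch|exact: cf].
have F0 k x : 0 <= F k x.
  by rewrite mulr_ge0 ?ramp_ge0//; case/andP: (fM (h x)).
have Ff k x : F k x <= f (h x).
  by rewrite ler_piMr ?ramp_le1//; case/andP: (fM (h x)).
have cVaff (g : V -> R) (a : V) (r : R) : continuous g ->
    continuous (fun x : V => g (a + r *: x)).
  move=> cg x; apply: (@continuous_comp _ _ _ (fun x : V => a + r *: x)).
    apply: cvgD; first exact: cvg_cst.
    by apply: cvgZr; exact: cvg_id.
  exact: cg.
have mV (g : V -> R) (a : V) (r : R) : continuous g ->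
    measurable_fun [set: T] (fun w => g (a + r *: X w)).
  move=> cg; exact: measurable_fun_comp_continuous mX (cVaff g a r cg).
have lim : (\int[P]_w (F k (x0 + 1 *: X w))%:E)%E @[k --> \oo] -->
    (\int[P]_w (f (a0 + h (X w)))%:E)%E.
  apply: (@dominated_cvg _ _ _ P _ measurableT _ _ (fun=> M%:E)) => //.
  - by move=> k; apply/measurable_EFinP; exact: mV.
  - move=> w _; apply: cvg_near_cst.
    pose N := Num.truncn `|x0 + 1 *: X w|.
    exists N.+1 => // k /= Nk.
    rewrite /F hlin hx0 mul1r /psi ramp_eq1 ?mulr1//.
    have : `|x0 + 1 *: X w| < N.+1%:R by exact: truncnS_gt.
    have : N.+1%:R <= k%:R :> R by rewrite ler_nat.
    lra.
  - exact: finite_measure_integrable_cst.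
  - move=> k w _; rewrite lee_fin ger0_norm//.
    by rewrite (le_trans (Ff _ _))//; case/andP: (fM (h (x0 + 1 *: X w))).
have [k _ /(_ k (leqnn k)) Fk] :=
  lim _ (open_nbhs_nbhs (conj (@open_ereal_gt_ereal R rho%:E) E1)).
exists (F k); split => //.
- split.
    apply: (measurability _ (RGenOpens.measurableE R)).
    move=> _ [_ [a [b ->] <-]]; rewrite setTI; apply: sub_sigma_algebra.
    by move/continuousP: (cF k); apply; exact: interval_open.
  by exists M => x; rewrite (le_trans (Ff _ _))//; case/andP: (fM (h x)).
- apply: subclosed_compact (Vcompact (k%:R + 1)) _; first exact: closed_closure.
  rewrite closureE => x; apply; split.
    apply: compact_closed => //; exact: norm_hausdorff.
  move=> y /=; apply: contraNT; rewrite -ltNge => yk.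
  by rewrite /F /psi ramp_eq0 ?mulr0//; lra.
- move=> /(_ c 1 c0 c1); apply/negP; rewrite -ltNge.
  apply: (@le_lt_trans _ _ rho%:E).
    apply: ge_ereal_sup => _ [a _ <-]; rewrite unlock.
    apply: le_trans (Ec (h a)); apply: ge0_le_integral => //.
    + by move=> w _; rewrite lee_fin.
    + by apply/measurable_EFinP; exact: mV.
    + apply/measurable_EFinP.
      apply: (measurableT_comp (continuous_measurable_fun cf)).
      by apply: measurable_funD => //; apply: measurable_funM.
    + by move=> w _; rewrite lee_fin -hlin.
  apply: (lt_le_trans Fk); apply: ereal_sup_ubound; exists x0 => //.
  by rewrite unlock.
Qed.

(** * Darts in coordinate spaces *)

Lemma scalar_row_continuous {R : realType} {n : nat} (h : {scalar 'rV[R]_n}) :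
  continuous h.
Proof.
rewrite (_ : (h : 'rV[R]_n -> R) =
    fun y => \sum_(i < n) y 0 i * h (delta_mx 0 i)); last first.
  apply/funext => y; rewrite {1}(row_sum_delta y) linear_sum.
  by apply: eq_bigr => i _; rewrite linearZ.
apply: continuous_big; first exact: add_continuous.
move=> i _ y; apply: (@continuous_comp _ _ _ (fun z : 'rV[R]_n => z 0 i)
  (fun t => t * h (delta_mx 0 i))); first exact: coord_continuous.
exact: mulrr_continuous.
Qed.

Theorem theorem1p14 (R : realType) (d : measure_display)
    (T : measurableType d) (P : probability T R) :
  (forall X : {RV P >-> R},
     nondegenerate_dart P (X : T -> R) -> compactly_supported P (X : T -> R) ->
     exists f : R -> R,
       [/\ payoff f, forall x, 0 <= f x, continuous f, compact_support f
         & ~ reasonable P (X : T -> R) f]) /\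
  (forall (n : nat) (X : {RV P >-> borel 'rV[R]_n}),
     (exists h : {scalar 'rV[R]_n},
        [/\ exists x, h x != 0,
            nondegenerate_dart P (fun w => h (X w) : R)
          & compactly_supported P (fun w => h (X w) : R)]) ->
     exists f : 'rV[R]_n -> R,
       [/\ payoff f, forall x, 0 <= f x, continuous f, compact_support f
         & ~ reasonable P (X : T -> 'rV[R]_n) f]).
Proof.
split.
- move=> X ndX csX.
  apply: (not_reasonable_of_projection P R X idfun) => //.
  + move=> k; rewrite (_ : [set x | _] = `[- k, k]%classic).
      exact: segment_compact.
    by apply/seteqP; split => x /=; rewrite in_itv/= ler_norml.
  + move=> O oO; rewrite -[X in measurable X]setTI.
    by apply: (measurable_funP X) => //; exact: open_measurable.
  + by move=> x; exact: cvg_id.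
  + by move=> t; exists t.
- move=> n X [h [[x hx] ndhX cshX]].
  apply: (not_reasonable_of_projection P 'rV[R]_n X h) => //.
  + move=> k; apply: bounded_closed_compact.
      exists k; split; first exact: num_real.
      by move=> l kl y /= yk; rewrite (le_trans yk)// ltW.
    apply: (@closed_comp _ _ (fun x : 'rV[R]_n => `|x|) [set r | r <= k]).
      by move=> y _; exact: norm_continuous.
    exact: closed_le.
  + move=> O oO; rewrite -[X in measurable X]setTI.
    by apply: (measurable_funP X) => //; apply: sub_sigma_algebra.
  + exact: scalar_row_continuous.
  + by move=> a c y; rewrite linearD linearZ.
  + by move=> t; exists ((t / h x) *: x); rewrite linearZ /= divfK.
Qed.
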